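(* Let $\mathscr K$ be a class of Hausdorff spaces and let $\mathscr K'$ be the class of all feebly open quotients of spaces from $\mathscr K$. Then every $C(\mathscr K)$-space $E$ is also a $C(\mathscr K')$-space, and every $C_s(\mathscr K)$-space is a $C_s(\mathscr K')$-space.
   Context: All topological spaces are Hausdorff. $\overline{A}$ denotes closure and $A^\circ$ interior. A mapping $g:G\to F$ is feebly open if $g(U)^\circ\neq\emptyset$ for every nonempty open $U\subseteq G$. A Hausdorff space $F$ is a feebly open quotient of $G$ if there is a continuous feebly open quotient map $g$ from $G$ onto $F$. A mapping $f:F\to E$ is nearly continuous if $f^{-1}(V)\subseteq \left(\overline{f^{-1}(V)}\right)^\circ$ for every open $V\subseteq E$. It is separating if for any $x,y\in E$ with $x\neq y$ there exist neighborhoods $V_x$ of $x$ and $V_y$ of $y$ in $E$ such that $\overline{f^{-1}(V_x)}\cap f^{-1}(V_y)=\emptyset=f^{-1}(V_x)\cap\overline{f^{-1}(V_y)}$. For a class $\mathscr K$ of Hausdorff spaces, a Hausdorff space $E$ is a $C(\mathscr K)$-space if for every $F\in\mathscr K$, every nearly continuous mapping $f:F\to E$ with closed graph is continuous; it is a $C_s(\mathscr K)$-space if for every $F\in\mathscr K$, every nearly continuous separating mapping $f:F\to E$ is continuous. *)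

(* Defs.v *)
From HB Require Import structures.
From mathcomp Require Import all_boot all_order.
From mathcomp Require Import all_classical topology.

Set Implicit Arguments.
Unset Strict Implicit.
Unset Printing Implicit Defensive.

Local Open Scope classical_set_scope.

Definition feebly_open (G F : topologicalType) (g : G -> F) : Prop :=
  forall U : set G, open U -> U !=set0 -> (g @` U)° !=set0.

(* Continuity is the left-to-right direction of the equivalence. *)
Definition quotient_map (G F : topologicalType) (g : G -> F) : Prop :=
  set_surj [set: G] [set: F] g /\
  forall V : set F, open V <-> open (g @^-1` V).

Definition feebly_open_quotient (F G : topologicalType) : Prop :=
  hausdorff_space F /\
  exists g : G -> F, [/\ continuous g, feebly_open g & quotient_map g].

Definition nearly_continuous (F E : topologicalType) (f : F -> E) : Prop :=
  forall V : set E, open V -> f @^-1` V `<=` (closure (f @^-1` V))°.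

Definition separating (F E : topologicalType) (f : F -> E) : Prop :=
  forall x y : E, x <> y ->
  exists Vx Vy : set E,
    [/\ nbhs x Vx, nbhs y Vy,
        closure (f @^-1` Vx) `&` f @^-1` Vy = set0 &
        f @^-1` Vx `&` closure (f @^-1` Vy) = set0].

Definition has_closed_graph (F E : topologicalType) (f : F -> E) : Prop :=
  closed [set p : F * E | f p.1 = p.2].

(* A class of spaces is a predicate [K] on [topologicalType], which allows the
   empty space; it is not assumed to be invariant under homeomorphism. *)
Definition C_space (K : topologicalType -> Prop) (E : topologicalType) : Prop :=
  hausdorff_space E /\
  forall F : topologicalType, K F ->
  forall f : F -> E, nearly_continuous f -> has_closed_graph f -> continuous f.

Definition Cs_space (K : topologicalType -> Prop) (E : topologicalType) : Prop :=
  hausdorff_space E /\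
  forall F : topologicalType, K F ->
  forall f : F -> E, nearly_continuous f -> separating f -> continuous f.

Definition feebly_open_quotients (K : topologicalType -> Prop)
    (F : topologicalType) : Prop :=
  exists G : topologicalType, K G /\ feebly_open_quotient F G.

(* Main.v *)
Require Import Defs.
From mathcomp Require Import all_boot all_order.
From mathcomp Require Import all_classical topology.

(** Let [g : G -> F] be a continuous feebly open quotient map and [f : F -> E].
    Every hypothesis on [f] considered here passes to [f \o g]: closedness of
    the graph and the separating property because [g] is continuous, and near
    continuity ([nearly_continuous_comp]) because preimages under [g] moreover
    preserve density, [g] being feebly open
    ([feebly_open_preimage_closure]).  As [G] belongs to the class, [f \o g] is
    then continuous, and since [g] is a quotient map, continuity descends from
    [f \o g] to [f] ([quotient_map_continuous]). *)

Local Open Scope classical_set_scope.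

(** A nonempty open [U] inside [g @^-1` W] has an image whose interior is
    nonempty and lies in [closure A], so it meets [A]; hence every such [U]
    meets [g @^-1` A]. *)
Lemma feebly_open_preimage_closure (G F : topologicalType) (g : G -> F)
    (A W : set F) :
  continuous g -> feebly_open g -> open W -> W `<=` closure A ->
  g @^-1` W `<=` closure (g @^-1` A).
Proof.
move=> gc gfo oW WA x Wx B; rewrite nbhsE => -[U [oU Ux] UB].
have oUW : open (U `&` g @^-1` W).
  by apply: openI => //; move/continuousP: gc; apply.
have [y intgy] := gfo _ oUW (ex_intro _ x (conj Ux Wx)).
have [u [_ Wu] guy] := interior_subset intgy.
have Ay : closure A y by apply: WA; rewrite -guy.
have [v [Av [z [Uz _] gz]]] := Ay _ intgy.
by exists z; split; [rewrite /preimage /= gz | exact: UB].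
Qed.

Lemma nearly_continuous_comp (G F E : topologicalType) (g : G -> F)
    (f : F -> E) :
  continuous g -> feebly_open g -> nearly_continuous f ->
  nearly_continuous (f \o g).
Proof.
move=> gc gfo fnc V oV x /(fnc V oV) Vx; rewrite comp_preimage.
have oW : open (closure (f @^-1` V))° by exact: open_interior.
suff : g @^-1` (closure (f @^-1` V))° `<=` (closure (g @^-1` (f @^-1` V)))°.
  by apply.
rewrite -open_subsetE; last by move/continuousP: gc; apply.
by apply: feebly_open_preimage_closure => //; exact: interior_subset.
Qed.

Lemma closed_graph_comp (G F E : topologicalType) (g : G -> F) (f : F -> E) :
  continuous g -> has_closed_graph f -> has_closed_graph (f \o g).
Proof.
move=> gc; apply: (@closed_comp _ _ (fun p : G * E => (g p.1, p.2))) => p _.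
apply: cvg_pair => /=; last exact: cvg_snd.
by apply: (@continuous_comp _ _ _ (@fst G E) g p); [exact: cvg_fst | exact: gc].
Qed.

Lemma continuous_closure_preimage (G F : topologicalType) (g : G -> F)
    (A : set F) :
  continuous g -> closure (g @^-1` A) `<=` g @^-1` (closure A).
Proof.
move=> gc x cx B /(gc x)/cx[z [Az Bz]].
by exists (g z).
Qed.

Lemma separating_comp (G F E : topologicalType) (g : G -> F) (f : F -> E) :
  continuous g -> separating f -> separating (f \o g).
Proof.
move=> gc fs x y /fs[Vx [Vy [nVx nVy xy0 yx0]]].
have clg A := continuous_closure_preimage _ _ g (f @^-1` A) gc.
exists Vx, Vy; split => //; rewrite -subset0 => z [Vxz Vyz].
- suff : set0 (g z) by [].
  by rewrite -xy0; split; [exact: clg Vxz | exact: Vyz].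
- suff : set0 (g z) by [].
  by rewrite -yx0; split; [exact: Vxz | exact: clg Vyz].
Qed.

Lemma quotient_map_continuous (G F E : topologicalType) (g : G -> F)
    (f : F -> E) :
  quotient_map g -> continuous (f \o g) -> continuous f.
Proof.
move=> [_ gq] /continuousP fgc; apply/continuousP => V oV.
by apply/gq; exact: fgc.
Qed.

Theorem proposition5 (K : topologicalType -> Prop)
    (hK : forall G : topologicalType, K G -> hausdorff_space G) :
  (forall E : topologicalType,
     C_space K E -> C_space (feebly_open_quotients K) E) /\
  (forall E : topologicalType,
     Cs_space K E -> Cs_space (feebly_open_quotients K) E).
Proof.
split=> E [hE EK]; split=> // F [G [KG [_ [g [gc gfo gq]]]]] f fnc fP;
  apply: (quotient_map_continuous _ _ _ _ _ gq); apply: EK => //.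
- exact: nearly_continuous_comp.
- exact: closed_graph_comp.
- exact: nearly_continuous_comp.
- exact: separating_comp.
Qed.
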